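(* The class $\mathsf{S2T}$ of source-to-target TGDs is destructive of arity-two QA, even when the whole signature $\sigma$ has arity two and there is no query. That is, the following satisfiability problem is undecidable: given a signature $\sigma$ all of whose relations have arity at most $2$, a $\sigma$-fact $F(\mathbf{x})$, a finite set $\Delta$ of source-to-target TGDs on $\sigma$, and a $\mathsf{GC}^2$ constraint $\Sigma$ on $\sigma$, decide whether there is an interpretation satisfying $(\exists \mathbf{x}~F(\mathbf{x})) \wedge \Sigma \wedge \Delta$.
   Context: A signature $\sigma$ is a finite set of relation names with arities; $\sigma_{\leq 2}$ and $\sigma_{>2}$ denote its relations of arity $\leq 2$ and $>2$. Atoms $R(\mathbf{x})$ use variables only (no constants). A $\sigma$-fact is a finite conjunction of atoms over $\sigma$. A CQ is an existentially quantified finite conjunction of atoms without free variables. Interpretations are relational structures, finite or infinite. QA (query answering): given a fact $F$, constraints $\Theta$ and a CQ $q$, decide whether $\forall \mathbf{x}~(F(\mathbf{x}) \wedge \Theta \rightarrow q)$ is valid over all interpretations. An existential rule (TGD) is a sentence $\forall \mathbf{x}~(\phi(\mathbf{x}) \rightarrow \exists \mathbf{y}~\psi(\mathbf{x'},\mathbf{y}))$ with $\mathbf{x'} \subseteq \mathbf{x}$, where the body $\phi$ and head $\psi$ are conjunctions of atoms without equality or constants. A set of rules is source-to-target ($\mathsf{S2T}$) if $\sigma$ is partitioned as $\sigma = \sigma_{\mathrm{S}} \sqcup \sigma_{\mathrm{T}}$ such that all rule bodies only use relations of $\sigma_{\mathrm{S}}$ and all rule heads only use relations of $\sigma_{\mathrm{T}}$.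 $\mathsf{GC}^2$ (two-variable guarded fragment with counting) is the smallest class of constant-free first-order formulas with at most two variables that contains all atoms for relations of $\sigma_{\leq 2}$ and is closed under Boolean connectives, under guarded universal and existential quantification (the quantified formula is guarded by an atom containing all its free variables), and under number quantification: if $\phi(x,y)$ is in $\mathsf{GC}^2$ and $A(x,y)$ is an arity-two atom with two free variables, then $\exists^{\geq n} y~A(x,y) \wedge \phi(x,y)$ and $\exists^{<n} y~A(x,y) \wedge \phi(x,y)$ are in $\mathsf{GC}^2$, for every integer $n$. The $\mathsf{GC}^2$ constraints need not respect the source/target partition. A class of existential rules is destructive (of arity-two QA) if QA is undecidable for conjunctions of rules of the class (on $\sigma$) and $\mathsf{GC}^2$ constraints (on $\sigma_{\leq 2}$). *)

(* Defs.v *)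
From mathcomp Require Import all_boot.

Set Implicit Arguments.
Unset Strict Implicit.
Unset Printing Implicit Defensive.

Inductive recf : nat -> Type :=
| RZero k : recf k
| RSucc : recf 1
| RProj k (i : 'I_k) : recf k
| RComp k m (f : recf m) (g : 'I_m -> recf k) : recf k
| RPrec k (f : recf k) (g : recf k.+2) : recf k.+1
| RMu k (f : recf k.+1) : recf k.

(* [reval f v r]: the partial function [f] is defined on [v], with value [r];
   only meaningful when [size v] is the arity of [f].  In the primitive
   recursion case, [t] is the table of the values at 0, ..., n. *)
Fixpoint reval k (f : recf k) : seq nat -> nat -> Prop :=
  match f with
  | RZero _ => fun v r => r = 0
  | RSucc => fun v r => r = (nth 0 v 0).+1
  | RProj _ i => fun v r => r = nth 0 v i
  | RComp _ m f g => fun v r => exists ws : seq nat,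
      [/\ size ws = m, forall i : 'I_m, reval (g i) v (nth 0 ws i)
        & reval f ws r]
  | RPrec _ f g => fun v r =>
      if v is n :: w then exists t : nat -> nat,
        [/\ reval f w (t 0),
            forall i, i < n -> reval g [:: i, t i & w] (t i.+1)
          & r = t n]
      else False
  | RMu _ f => fun v r =>
      reval f (r :: v) 0 /\
      (forall i, i < r -> exists j, reval f (i :: v) j.+1)
  end.

(* Inputs outside [dom] are not legal instances: nothing is required of the
   algorithm there. *)
Definition decidable_on (T : Type) (code : T -> nat) (dom P : T -> Prop) :=
  exists f : recf 1, forall x, dom x ->
    (P x -> reval f [:: code x] 1) /\ (~ P x -> reval f [:: code x] 0).

Definition undecidable_on (T : Type) (code : T -> nat) (dom P : T -> Prop) :=
  ~ decidable_on code dom P.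

(* [nth 0 sg i] is the arity of the relation named [i < size sg]. *)
Definition signature := seq nat.

Definition atom (V : Type) : Type := (nat * seq V)%type.

Definition atom_on (V : Type) (sg : signature) (a : atom V) : bool :=
  (a.1 < size sg) && (size a.2 == nth 0 sg a.1).

(* Only the values on names of the signature, at lists whose length is the
   arity, are ever used. *)
Definition interp (D : Type) := nat -> seq D -> Prop.

Definition holds (V D : Type) (I : interp D) (e : V -> D) (a : atom V) : Prop :=
  I a.1 [seq e x | x <- a.2].

Definition conj := seq (atom nat).

Definition conj_on (sg : signature) (c : conj) : bool := all (atom_on sg) c.

Definition holds_conj (D : Type) (I : interp D) (e : nat -> D) (c : conj) :=
  forall a, a \in c -> holds I e a.

Definition conj_vars (c : conj) : seq nat := flatten [seq a.2 | a <- c].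

(* The universal variables are those of the body; the variables of the head
   that do not occur in the body are existential. *)
Definition tgd : Type := (conj * conj)%type.

Definition body (r : tgd) : conj := r.1.
Definition head (r : tgd) : conj := r.2.

Definition tgd_on (sg : signature) (r : tgd) : bool :=
  conj_on sg (body r) && conj_on sg (head r).

Definition tgd_sat (D : Type) (I : interp D) (r : tgd) : Prop :=
  forall e, holds_conj I e (body r) ->
  exists e', {in conj_vars (body r), e' =1 e} /\ holds_conj I e' (head r).

Definition s2t (rs : seq tgd) : Prop :=
  exists src : pred nat, forall r, r \in rs ->
    all (fun a => src a.1) (body r) && all (fun a => ~~ src a.1) (head r).

(* The two variables are [false] and [true].
     GAll xs a p     : forall xs, a -> p
     GEx xs a p      : exists xs, a /\ p
     GAtLeast n y a p : there are at least n values of y such that a /\ p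
     GLess n y a p   : there are fewer than n values of y such that a /\ p *)
Inductive gform :=
| GAtom (a : atom bool)
| GNot (p : gform)
| GAnd (p q : gform)
| GOr (p q : gform)
| GAll (xs : seq bool) (a : atom bool) (p : gform)
| GEx (xs : seq bool) (a : atom bool) (p : gform)
| GAtLeast (n : nat) (y : bool) (a : atom bool) (p : gform)
| GLess (n : nat) (y : bool) (a : atom bool) (p : gform).

Fixpoint free_vars (p : gform) : seq bool :=
  match p with
  | GAtom a => a.2
  | GNot p => free_vars p
  | GAnd p q | GOr p q => free_vars p ++ free_vars q
  | GAll xs a p | GEx xs a p => [seq z <- a.2 ++ free_vars p | z \notin xs]
  | GAtLeast _ y a p | GLess _ y a p => [seq z <- a.2 ++ free_vars p | z != y]
  end.

Definition atom2_on (sg : signature) (a : atom bool) : bool :=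
  atom_on sg a && (size a.2 <= 2).

(* Membership in GC^2 on the relations of [sg] of arity at most 2. *)
Fixpoint gc2 (sg : signature) (p : gform) : bool :=
  match p with
  | GAtom a => atom2_on sg a
  | GNot p => gc2 sg p
  | GAnd p q | GOr p q => gc2 sg p && gc2 sg q
  | GAll _ a p | GEx _ a p =>
      [&& atom2_on sg a, all [in a.2] (free_vars p) & gc2 sg p]
  | GAtLeast _ _ a p | GLess _ _ a p =>
      [&& atom2_on sg a, size a.2 == 2, uniq a.2 & gc2 sg p]
  end.

Definition at_least (D : Type) (n : nat) (P : D -> Prop) : Prop :=
  exists f : 'I_n -> D, injective f /\ forall i, P (f i).

Definition upd (D : Type) (e : bool -> D) (y : bool) (d : D) : bool -> D :=
  fun z => if z == y then d else e z.

Fixpoint gsat (D : Type) (I : interp D) (p : gform) (e : bool -> D) : Prop :=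
  match p with
  | GAtom a => holds I e a
  | GNot p => ~ gsat I p e
  | GAnd p q => gsat I p e /\ gsat I q e
  | GOr p q => gsat I p e \/ gsat I q e
  | GAll xs a p => forall e', (forall z, z \notin xs -> e' z = e z) ->
      holds I e' a -> gsat I p e'
  | GEx xs a p => exists e', (forall z, z \notin xs -> e' z = e z) /\
      (holds I e' a /\ gsat I p e')
  | GAtLeast n y a p =>
      at_least n (fun d => holds I (upd e y d) a /\ gsat I p (upd e y d))
  | GLess n y a p =>
      ~ at_least n (fun d => holds I (upd e y d) a /\ gsat I p (upd e y d))
  end.

Record instance := Instance {
  sig : signature;
  fact : conj;
  rules : seq tgd;
  constr : gform
}.

Definition legal (x : instance) : Prop :=
  [/\ all (fun n => n <= 2) (sig x),
      conj_on (sig x) (fact x),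
      all (tgd_on (sig x)) (rules x),
      s2t (rules x)
    & gc2 (sig x) (constr x) /\ free_vars (constr x) = [::]].

(* The existence of [e] forces the domain to be nonempty. *)
Definition satisfiable (x : instance) : Prop :=
  exists (D : Type) (I : interp D),
    [/\ exists e : nat -> D, holds_conj I e (fact x),
        forall r, r \in rules x -> tgd_sat I r
      & forall e : bool -> D, gsat I (constr x) e].

(* Cantor pairing. *)
Definition cpair (a b : nat) : nat := 'C((a + b).+1, 2) + b.

Fixpoint code_seq (T : Type) (c : T -> nat) (s : seq T) : nat :=
  if s is x :: s' then (cpair (c x) (code_seq c s')).+1 else 0.

Definition code_atom (V : Type) (c : V -> nat) (a : atom V) : nat :=
  cpair a.1 (code_seq c a.2).

Definition code_conj (c : conj) : nat := code_seq (code_atom id) c.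

Definition code_tgd (r : tgd) : nat :=
  cpair (code_conj (body r)) (code_conj (head r)).

Definition code_gatom (a : atom bool) : nat := code_atom nat_of_bool a.

Definition code_vars (xs : seq bool) : nat := code_seq nat_of_bool xs.

Fixpoint code_gform (p : gform) : nat :=
  match p with
  | GAtom a => cpair 0 (code_gatom a)
  | GNot p => cpair 1 (code_gform p)
  | GAnd p q => cpair 2 (cpair (code_gform p) (code_gform q))
  | GOr p q => cpair 3 (cpair (code_gform p) (code_gform q))
  | GAll xs a p =>
      cpair 4 (cpair (code_vars xs) (cpair (code_gatom a) (code_gform p)))
  | GEx xs a p =>
      cpair 5 (cpair (code_vars xs) (cpair (code_gatom a) (code_gform p)))
  | GAtLeast n y a p =>
      cpair 6 (cpair n (cpair y (cpair (code_gatom a) (code_gform p))))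
  | GLess n y a p =>
      cpair 7 (cpair n (cpair y (cpair (code_gatom a) (code_gform p))))
  end.

Definition code_instance (x : instance) : nat :=
  cpair (code_seq id (sig x))
    (cpair (code_conj (fact x))
      (cpair (code_seq code_tgd (rules x)) (code_gform (constr x)))).

Lemma cpair_inj a b a' b' : cpair a b = cpair a' b' -> a = a' /\ b = b'.
Proof.
have lt s s' t t' : t <= s -> s < s' -> 'C(s.+1, 2) + t < 'C(s'.+1, 2) + t'.
  move=> ts ss'; apply: (@leq_trans 'C(s.+2, 2)).
    by rewrite [X in _ < X]binS bin1 ltn_add2l ltnS.
  by apply: leq_trans (leq_addr _ _); apply: leq_bin2l.
rewrite /cpair => h; case: (ltngtP (a + b) (a' + b')) => [l|l|e].
- by have := lt _ _ _ b' (leq_addl a b) l; rewrite h ltnn.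
- by have := lt _ _ _ b (leq_addl a' b') l; rewrite h ltnn.
by move: h; rewrite e => /addnI eb; move: e; rewrite eb => /addIn.
Qed.

Lemma code_seq_inj T (c : T -> nat) : injective c -> injective (code_seq c).
Proof.
move=> ci; elim=> [|x s IH] [|y s'] //= [] /cpair_inj[/ci-> /IH->]; by [].
Qed.

Lemma code_atom_inj V (c : V -> nat) : injective c -> injective (code_atom c).
Proof. by move=> ci [r s] [r' s'] /cpair_inj[/= -> /(code_seq_inj ci)->]. Qed.

Lemma code_conj_inj : injective code_conj.
Proof. exact: code_seq_inj (code_atom_inj (@inj_id _)). Qed.

Lemma code_tgd_inj : injective code_tgd.
Proof.
by move=> [b h] [b' h'] /cpair_inj[/= /code_conj_inj-> /code_conj_inj->].
Qed.

Lemma nat_of_bool_inj : injective nat_of_bool.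
Proof. by case; case. Qed.

Lemma code_gform_inj : injective code_gform.
Proof.
have ai := code_atom_inj nat_of_bool_inj.
have vi := code_seq_inj nat_of_bool_inj.
elim=> [a|p IH|p IHp q IHq|p IHp q IHq|xs a p IH|xs a p IH|n y a p IH|n y a p IH];
  case=> [a'|p'|p' q'|p' q'|xs' a' p'|xs' a' p'|n' y' a' p'|n' y' a' p'] /=;
  case/cpair_inj=> // _.
- by move/ai->.
- by move/IH->.
- by case/cpair_inj=> /IHp-> /IHq->.
- by case/cpair_inj=> /IHp-> /IHq->.
- by case/cpair_inj=> /vi-> /cpair_inj[/ai-> /IH->].
- by case/cpair_inj=> /vi-> /cpair_inj[/ai-> /IH->].
- by case/cpair_inj=> -> /cpair_inj[/nat_of_bool_inj-> /cpair_inj[/ai-> /IH->]].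
- by case/cpair_inj=> -> /cpair_inj[/nat_of_bool_inj-> /cpair_inj[/ai-> /IH->]].
Qed.

Lemma code_instance_inj : injective code_instance.
Proof.
case=> [s f r c] [s' f' r' c'] /cpair_inj[/= /(code_seq_inj (@inj_id _))->].
case/cpair_inj=> /code_conj_inj-> /cpair_inj[].
by move=> /(code_seq_inj code_tgd_inj)-> /code_gform_inj->.
Qed.

Lemma reval_fun k (f : recf k) v r r' : reval f v r -> reval f v r' -> r = r'.
Proof.
elim: f v r r' => {k} [k|||k m f IHf g IHg|k f IHf g IHg|k f IHf] /=.
- by move=> v r r' -> ->.
- by move=> v r r' -> ->.
- by move=> k i v r r' -> ->.
- move=> v r r' [ws [sz hg hf]] [ws' [sz' hg' hf']].
  suff e : ws = ws' by move: hf'; rewrite -e; exact: IHf.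
  apply: (@eq_from_nth _ 0) => [|i]; first by rewrite sz.
  by rewrite sz => im; exact: (IHg (Ordinal im) _ _ _ (hg _) (hg' _)).
- case=> [//|n w] r r' [t [t0 tS ->]] [t' [t0' tS' ->]].
  suff E i : i <= n -> t i = t' i by exact: E.
  elim: i => [_|i IH lin]; first exact: IHf t0 t0'.
  by move: (tS' i lin); rewrite -IH ?(ltnW lin) // => h; exact: IHg (tS i lin) h.
move=> v r r' [h0 h] [h0' h']; case: (ltngtP r r') => // l.
  by have [j hj] := h' _ l; have := IHf _ _ _ h0 hj.
by have [j hj] := h _ l; have := IHf _ _ _ h0' hj.
Qed.

(* Main.v *)
(* A recursive function is evaluated by Horn rules over binary relations: the
   domain consists of numbers (zero, successor) and of lists of numbers (head,
   tail), and each subterm of the function is a relation between the list of its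
   arguments and its value.  The rules only create successors and list cells, so
   the only obstruction to a model is the derivation of the value 1, which a
   guarded constraint forbids: the instance is satisfiable iff the function does
   not return 1.  Being source-to-target is no restriction, since rules can
   derive a target copy of each relation, which guarded constraints copy back.
   Were satisfiability decided by f, let d (a, b) be f applied to the code of
   the instance whose input fact encodes (a, b), and whose signature, and rules
   with constraint, have codes a and b; the instance where a and b are the codes
   coming from d itself yields a contradiction. *)
Require Import Defs.
From mathcomp Require Import all_boot.
From Stdlib Require Import ClassicalEpsilon.

Set Implicit Arguments.
Unset Strict Implicit.
Unset Printing Implicit Defensive.

(** * Horn rules over binary relations *)

Definition batom : Type := (nat * nat * nat)%type.

Definition brule : Type := (seq batom * seq batom)%type.

Definition bvars (b : seq batom) : seq nat :=
  flatten [seq [:: a.1.2; a.2] | a <- b].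

(** A recursive conjunction, so that concrete bodies split by simplification. *)
Fixpoint bholds (D : Type) (J : nat -> D -> D -> Prop) (e : nat -> D)
    (b : seq batom) : Prop :=
  if b is a :: b' then J a.1.1 (e a.1.2) (e a.2) /\ bholds J e b' else True.

Definition bsat (D : Type) (J : nat -> D -> D -> Prop) (r : brule) : Prop :=
  forall e, bholds J e r.1 ->
  exists e', {in bvars r.1, e' =1 e} /\ bholds J e' r.2.

Lemma bholds_in D (J : nat -> D -> D -> Prop) e b :
  bholds J e b <-> forall a, a \in b -> J a.1.1 (e a.1.2) (e a.2).
Proof.
elim: b => [|a b IH] /=; first by split.
split=> [[ha /IH hb] c|h].
  by rewrite inE => /orP[/eqP->|/hb].
split; first by apply: h; rewrite inE eqxx.
by apply/IH => c cb; apply: h; rewrite inE cb orbT.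
Qed.

Lemma bholds_cat D (J : nat -> D -> D -> Prop) e b b' :
  bholds J e (b ++ b') <-> bholds J e b /\ bholds J e b'.
Proof. by elim: b => [|a b IH] /=; tauto. Qed.

Lemma bholds_mkseq D (J : nat -> D -> D -> Prop) e (F : nat -> batom) n :
  bholds J e (mkseq F n) <->
  forall i, i < n -> J (F i).1.1 (e (F i).1.2) (e (F i).2).
Proof.
rewrite bholds_in; split=> [h i lin|h a /mapP[i]].
  by apply: h; apply: map_f; rewrite mem_iota.
by rewrite mem_iota /= => lin ->; exact: h.
Qed.

(** * Rules evaluating a recursive function *)

Definition rZ := 0.
Definition rS := 1.
Definition rL := 2.
Definition rNil := 3.
Definition rHd := 4.
Definition rTl := 5.
Definition rIn1 := 6.
Definition rIn2 := 7.
Definition rGoal := 8.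
(** The offset 9 skips the fixed names, and [pickle] keeps distinct paths apart. *)
Definition rE (p : seq nat) := (pickle p).+4.+4.+1.

(* Variables 0 and 1 hold the two arguments of the head, a list and a number;
   the two guards make them occur in the body, with 2 as the successor of 1. *)
Definition drule (R : nat) (b : seq batom) : brule :=
  ((rL, 0, 0) :: (rS, 1, 2) :: b, [:: (R, 0, 1)]).

(** Both head variables occur in the guards, so nothing is existential and the rule is plain
    Datalog. *)
Lemma bsat_drule D (J : nat -> D -> D -> Prop) R b :
  bsat J (drule R b) <->
  (forall e, J rL (e 0) (e 0) -> J rS (e 1) (e 2) -> bholds J e b ->
     J R (e 0) (e 1)).
Proof.
split=> [h e hL hS hb|h e /= [hL [hS hb]]].
  have [e' [ee' [/= hR _]]] := h e (Logic.conj hL (Logic.conj hS hb)).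
  by rewrite -!ee' ?inE ?eqxx ?orbT.
by exists e; split=> //; split=> //; exact: h.
Qed.

(** The variable of the suffix reached after [j] tails; 1 and 2 are reserved by [drule]. *)
Definition proj_var (j : nat) := if j is j'.+1 then j'.+3 else 0.

Definition proj_rule (R i : nat) : brule :=
  drule R (rcons (mkseq (fun j => (rTl, proj_var j, proj_var j.+1)) i)
                 (rHd, proj_var i, 1)).

(* Variables [i.*2.+3] are the values of the inner functions, and [i.*2.+4]
   the suffixes of the list of these values. *)
Definition comp_rule (R Rf : nat) (Rg : nat -> nat) (m : nat) : brule :=
  drule R (mkseq (fun i => (Rg i, 0, i.*2.+3)) m
           ++ mkseq (fun i => (rHd, i.*2.+4, i.*2.+3)) m
           ++ mkseq (fun i => (rTl, i.*2.+4, i.+1.*2.+4)) m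
           ++ [:: (rNil, m.*2.+4, m.*2.+4); (Rf, 4, 1)]).

(** In the second rule 3, 4, 5 stand for [n.+1], [n], [w]; 6 is [n :: w], with value 7; 9 is that
    value consed onto [w], and 8 is [n] consed onto 9. *)
Definition prec_rules (R Rf Rg : nat) : seq brule :=
  [:: drule R [:: (rHd, 0, 3); (rZ, 3, 3); (rTl, 0, 4); (Rf, 4, 1)];
      drule R [:: (rHd, 0, 3); (rS, 4, 3); (rTl, 0, 5); (rHd, 6, 4);
                  (rTl, 6, 5); (R, 6, 7); (rHd, 8, 4); (rTl, 8, 9);
                  (rHd, 9, 7); (rTl, 9, 5); (Rg, 8, 1)]].

(* [Rs v r]: the inner function is positive on [i :: v] for all [i < r]. *)
Definition mu_rules (R Rf Rs : nat) : seq brule :=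
  [:: drule Rs [:: (rZ, 1, 1)];
      drule Rs [:: (Rs, 0, 3); (rS, 3, 1); (rHd, 4, 3); (rTl, 4, 0);
                   (Rf, 4, 5); (rS, 6, 5)];
      drule R [:: (Rs, 0, 1); (rHd, 3, 1); (rTl, 3, 0); (Rf, 3, 4);
                  (rZ, 4, 4)]].

(* [N] names the subterms, given by their paths from the root. *)
Fixpoint eval_rules k (f : recf k) (N : seq nat -> nat) : seq brule :=
  match f with
  | RZero _ => [:: drule (N [::]) [:: (rZ, 1, 1)]]
  | RSucc => [:: drule (N [::]) [:: (rHd, 0, 3); (rS, 3, 1)]]
  | RProj _ i => [:: proj_rule (N [::]) i]
  | RComp _ m f g =>
      comp_rule (N [::]) (N [:: 0]) (fun i => N [:: i.+1]) m
      :: eval_rules f (N \o cons 0)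
      ++ flatten [seq eval_rules (g i) (N \o cons i.+1) | i <- enum 'I_m]
  | RPrec _ f g =>
      prec_rules (N [::]) (N [:: 0]) (N [:: 1])
      ++ eval_rules f (N \o cons 0) ++ eval_rules g (N \o cons 1)
  | RMu _ f =>
      mu_rules (N [::]) (N [:: 0]) (N [:: 1]) ++ eval_rules f (N \o cons 0)
  end.

(** This rule and [cons_rule] are the only ones with an existential variable. No relation singles
    out the numbers: an [rS] edge identifies them. *)
Definition succ_rule : brule := ([:: (rS, 0, 1)], [:: (rS, 1, 2)]).

Definition cons_rule : brule :=
  ([:: (rS, 0, 1); (rL, 2, 2)], [:: (rL, 3, 3); (rHd, 3, 0); (rTl, 3, 2)]).

(** Variables 3 and 4 are the inputs, 0 the list of both, and its value 1 is the successor of the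
    zero 7. *)
Definition goal_rule : brule :=
  drule rGoal
    [:: (rIn1, 3, 3); (rIn2, 4, 4); (rNil, 5, 5); (rHd, 6, 4); (rTl, 6, 5);
        (rHd, 0, 3); (rTl, 0, 6); (rE [::], 0, 1); (rZ, 7, 7); (rS, 7, 1)].

Definition all_rules (f : recf 2) : seq brule :=
  [:: succ_rule, cons_rule, goal_rule & eval_rules f rE].

(** * Completeness: every defined value is derived *)

Section Completeness.

Variables (D : Type) (J : nat -> D -> D -> Prop).
Variables (num : nat -> D) (lst : seq nat -> D).
Hypothesis numZ : J rZ (num 0) (num 0).
Hypothesis numS : forall i, J rS (num i) (num i.+1).
Hypothesis lstL : forall v, J rL (lst v) (lst v).
Hypothesis lst_nil : J rNil (lst [::]) (lst [::]).
Hypothesis lst_hd : forall i v, J rHd (lst (i :: v)) (num i).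
Hypothesis lst_tl : forall i v, J rTl (lst (i :: v)) (lst v).

Lemma drule_derive R b v r e :
  bsat J (drule R b) -> e 0 = lst v -> e 1 = num r -> e 2 = num r.+1 ->
  bholds J e b -> J R (lst v) (num r).
Proof.
by move=> /bsat_drule h e0 e1 e2 hb; rewrite -e0 -e1; apply: h;
  rewrite ?e0 ?e1 ?e2.
Qed.

Lemma proj_rule_derive R i v :
  bsat J (proj_rule R i) -> i < size v -> J R (lst v) (num (nth 0 v i)).
Proof.
move=> h liv.
pose e n := match n with 0 => lst v | 1 => num (nth 0 v i)
  | 2 => num (nth 0 v i).+1 | j.+3 => lst (drop j.+1 v) end.
have eP j : e (proj_var j) = lst (drop j v) by case: j => //=; rewrite drop0.
apply: (drule_derive (e := e) h) => //.
rewrite -cats1; apply/bholds_cat; split; last first.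
  by rewrite /= eP (drop_nth 0 liv).
apply/bholds_mkseq => j lji; rewrite !eP (drop_nth 0) //.
exact: ltn_trans lji liv.
Qed.

Lemma comp_rule_derive R Rf Rg m v ws r :
  bsat J (comp_rule R Rf Rg m) -> size ws = m ->
  (forall i, i < m -> J (Rg i) (lst v) (num (nth 0 ws i))) ->
  J Rf (lst ws) (num r) -> J R (lst v) (num r).
Proof.
move=> h sz hg hf.
(* Past the three variables of [drule], values and suffixes of [ws] alternate. *)
pose e n := match n with 0 => lst v | 1 => num r | 2 => num r.+1
  | j.+3 => if odd j then lst (drop j./2 ws) else num (nth 0 ws j./2) end.
have eX i : e i.*2.+3 = num (nth 0 ws i) by rewrite /= odd_double doubleK.
have eW i : e i.*2.+4 = lst (drop i ws).
  by rewrite /= odd_double /= uphalf_double.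
apply: (drule_derive (e := e) h) => //.
rewrite !bholds_cat !bholds_mkseq.
split; [|split; [|split]] => [i lim|i lim|i lim|].
- by have := hg i lim; rewrite -eX.
- by have := lst_hd (nth 0 ws i) (drop i.+1 ws); rewrite -eX -drop_nth ?sz // -eW.
- have := lst_tl (nth 0 ws i) (drop i.+1 ws).
  by rewrite -drop_nth ?sz // -!eW.
have em : e m.*2.+4 = lst [::] by rewrite eW drop_oversize ?sz.
have ew : e 4 = lst ws by rewrite (eW 0) drop0.
by have := lst_nil; rewrite -em -ew in hf *.
Qed.

Lemma prec_rules_derive R Rf Rg w n t :
  (forall r, r \in prec_rules R Rf Rg -> bsat J r) ->
  J Rf (lst w) (num (t 0)) ->
  (forall i, i < n -> J Rg (lst [:: i, t i & w]) (num (t i.+1))) ->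
  J R (lst (n :: w)) (num (t n)).
Proof.
move=> h; have h0 := h _ (mem_head _ _).
have {h} h1 : bsat J _ := h _ (mem_last _ _).
move=> hf; elim: n => [_|n IH hg].
  apply: (drule_derive (e := nth (num (t 0).+1)
    [:: lst (0 :: w); num (t 0); num (t 0).+1; num 0; lst w]) h0) => //=.
have {}IH : J R (lst (n :: w)) (num (t n)).
  by apply: IH => i lin; apply: hg; apply: ltnW.
apply: (drule_derive (e := nth (num 0)
  [:: lst (n.+1 :: w); num (t n.+1); num (t n.+1).+1; num n.+1; num n; lst w;
      lst (n :: w); num (t n); lst [:: n, t n & w]; lst (t n :: w)]) h1) => //=.
by do !split=> //; exact: hg.
Qed.

Lemma mu_rules_derive R Rf Rs v r :
  (forall r, r \in mu_rules R Rf Rs -> bsat J r) ->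
  J Rf (lst (r :: v)) (num 0) ->
  (forall i, i < r -> exists j, J Rf (lst (i :: v)) (num j.+1)) ->
  J R (lst v) (num r).
Proof.
move=> h; have h0 := h _ (mem_head _ _).
have h1 : bsat J (nth succ_rule (mu_rules R Rf Rs) 1) by apply: h; rewrite mem_nth.
rewrite /= in h1; have {h} h2 : bsat J _ := h _ (mem_last _ _).
move=> hf hi.
(* The first two rules climb [Rs] from 0 to [r]; the last one then concludes. *)
suff hs : J Rs (lst v) (num r).
  apply: (drule_derive (e := nth (num 0)
    [:: lst v; num r; num r.+1; lst (r :: v); num 0]) h2) => //=.
elim: r hi {hf} => [_|r IH hi].
  by apply: (drule_derive (e := nth (num 0) [:: lst v; num 0; num 1]) h0) => //=.
have {}IH : J Rs (lst v) (num r).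
  by apply: IH => i lir; apply: hi; apply: ltnW.
have [j hj] := hi r (ltnSn r).
by apply: (drule_derive (e := nth (num 0)
  [:: lst v; num r.+1; num r.+2; num r; lst (r :: v); num j.+1; num j]) h1) => //=.
Qed.

(** Induction on [f] with [N] general, since the names for a subterm are [N \o cons i]. The model
    may be nonstandard: only the chosen elements [num] and [lst] are followed. *)
Lemma eval_rules_complete k (f : recf k) N :
  (forall r, r \in eval_rules f N -> bsat J r) ->
  forall v r, size v = k -> reval f v r -> J (N [::]) (lst v) (num r).
Proof.
elim: f N => {k} [k||k i|k m f IHf g IHg|k f IHf g IHg|k f IHf] N h v r sz /=.
- move=> ->; apply: (drule_derive (e := nth (num 0) [:: lst v; num 0; num 1])
    (h _ (mem_head _ _))) => //=.
- case: v sz => [|x [|]] //= _ ->.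
  by apply: (drule_derive (e := nth (num 0)
    [:: lst [:: x]; num x.+1; num x.+2; num x]) (h _ (mem_head _ _))) => //=.
- by move=> ->; apply: proj_rule_derive; [apply: h; rewrite inE | rewrite sz].
- case=> ws [szw hg hf].
  apply: (comp_rule_derive (h _ (mem_head _ _)) szw).
    move=> i lim; apply: (IHg (Ordinal lim) (N \o cons i.+1));
      [move=> s hs | by [] | exact: (hg (Ordinal lim))].
    apply: h; rewrite inE mem_cat; apply/orP; right; apply/orP; right.
    by apply/flatten_mapP; exists (Ordinal lim); rewrite ?mem_enum.
  apply: (IHf (N \o cons 0)) => // s hs.
  by apply: h; rewrite inE mem_cat hs orbT.
- case: v sz => [//|n w] [sz] [t [t0 tS ->]].
  apply: (@prec_rules_derive _ (N [:: 0]) (N [:: 1])) => [s hs||i lin].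
  + by apply: h; rewrite mem_cat hs.
  + by apply: (IHf (N \o cons 0)) => // s hs; apply: h; rewrite !mem_cat hs orbT.
  apply: (IHg (N \o cons 1)); [|by rewrite /= sz|exact: tS].
  by move=> s hs; apply: h; rewrite !mem_cat hs !orbT.
case=> hf hi.
have H u y : size u = k.+1 -> reval f u y -> J (N [:: 0]) (lst u) (num y).
  by apply: (IHf (N \o cons 0)) => s hs; apply: h; rewrite mem_cat hs orbT.
apply: (@mu_rules_derive _ (N [:: 0]) (N [:: 1])) => [s hs||i lir].
- by apply: h; rewrite mem_cat hs.
- by apply: H hf; rewrite /= sz.
by have [j hj] := hi i lir; exists j; apply: H hj; rewrite /= sz.
Qed.

End Completeness.

(** * Soundness: the standard model of numbers and lists *)

(** The intended meaning of the relation named by a path. Below [RMu], a nonzero step denotes the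
    auxiliary search relation; paths leading nowhere get the empty relation. *)
Fixpoint sem k (f : recf k) (p : seq nat) : seq nat -> nat -> Prop :=
  if p is i :: q then
    match f with
    | RComp _ m f g =>
        if i is j.+1 then
          if insub j is Some j' then sem (g j') q else fun _ _ => False
        else sem f q
    | RPrec _ f g => if i is 0 then sem f q else sem g q
    | RMu _ f =>
        if i is 0 then sem f q
        else fun v r => forall i, i < r -> exists j, reval f (i :: v) j.+1
    | _ => fun _ _ => False
    end
  else reval f.

Lemma sem_nil k (f : recf k) : sem f [::] = reval f.
Proof. by case: f. Qed.

(** The cases follow the numbering of the fixed names; [rGoal], which is 8, falls into the default
    and is empty. *)
Definition std (E : seq nat -> seq nat -> nat -> Prop) (a b : nat)
    (R : nat) (x y : nat + seq nat) : Prop :=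
  match R, x, y with
  | 0, inl i, inl j => i = 0 /\ j = 0
  | 1, inl i, inl j => j = i.+1
  | 2, inr v, inr w => v = w
  | 3, inr v, inr w => v = [::] /\ w = [::]
  | 4, inr v, inl i => exists w, v = i :: w
  | 5, inr v, inr w => exists i, v = i :: w
  | 6, inl i, inl j => i = a /\ j = a
  | 7, inl i, inl j => i = b /\ j = b
  | R'.+4.+4.+1, inr v, inl r =>
      if unpickle R' is Some p then E p v r else False
  | _, _, _ => False
  end.

Section Soundness.

Variables (E : seq nat -> seq nat -> nat -> Prop) (a b : nat).
Let J := std E a b.

Definition means (R : nat) (P : seq nat -> nat -> Prop) :=
  forall x y, J R x y = if (x, y) is (inr v, inl r) then P v r else False.

(** In the standard model the guards sort the head variables: 0 must be a list and 1 a number. *)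
Lemma drule_sound R P bd :
  means R P ->
  (forall e v r, e 0 = inr v -> e 1 = inl r -> bholds J e bd -> P v r) ->
  bsat J (drule R bd).
Proof.
move=> hR h; apply/bsat_drule => e.
case e0: (e 0) => [//|v] _; case e1: (e 1) => [r|//] _ hb.
by rewrite hR; apply: h hb.
Qed.

Lemma proj_rule_sound R i :
  means R (fun v r => r = nth 0 v i) -> bsat J (proj_rule R i).
Proof.
move=> hR; apply: (drule_sound hR) => e v r e0 e1.
rewrite -cats1 => /bholds_cat[/bholds_mkseq ht /= [hh _]].
have ev j : j <= i -> e (proj_var j) = inr (drop j v).
  elim: j => [_|j IH lji]; first by rewrite drop0.
  have := ht j lji; rewrite (IH (ltnW lji)) /J /=.
  case: (e j.+3) => // w [x dv].
  by rewrite -addn1 addnC -drop_drop dv /= drop0.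
move: hh; rewrite (ev i (leqnn i)) e1 => -[w dv].
by rewrite -[i]addn0 -nth_drop dv.
Qed.

Lemma comp_rule_sound R Rf (Rg : nat -> nat) k m (f : recf m) (g : 'I_m -> recf k) :
  means R (reval (RComp f g)) -> means Rf (reval f) ->
  (forall i : 'I_m, means (Rg i) (reval (g i))) ->
  bsat J (comp_rule R Rf Rg m).
Proof.
move=> hR hf hg; apply: (drule_sound hR) => e v r e0 e1.
rewrite !bholds_cat !bholds_mkseq => -[h1 [h2 [h3 [h4 [h5 _]]]]].
(* Read backwards from the [rNil] atom: the suffix variable [j] places before the end holds a list
   of length exactly [j], whose entries are the value variables. *)
have /= h : forall j, j <= m ->
    exists ws, [/\ e (m - j).*2.+4 = inr ws, size ws = j
      & forall i, i < j -> e (m - j + i).*2.+3 = inl (nth 0 ws i)].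
  elim=> [_|j IH ljm].
    rewrite subn0; move: h4 => /=; case: (e _) => // w [-> _]; by exists [::].
  have [ws []] := IH (ltnW ljm).
  have ljm' : m - j.+1 < m by rewrite ltn_subrL; case: (m) ljm.
  have dm : m - j = (m - j.+1).+1 by rewrite subnSK.
  rewrite dm => ew sz hw; have := h3 _ ljm'; have := h2 _ ljm'.
  move=> /=; rewrite /= in ew; rewrite ew.
  case e4: (e _) => [//|w]; case e3: (e _) => [x|//] [w' dw] [x' dw'].
  move: dw'; rewrite dw => -[_ ew']; exists w; rewrite dw ew' /=.
  split=> //; first by rewrite sz.
  case=> [_|i lij]; first by rewrite addn0.
  by rewrite addnS -addSn -hw.
have {h} [ws []] := h m (leqnn m).
rewrite subnn => /= e4 sz hw; exists ws; split=> // [i|].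
  by have := h1 i (ltn_ord i); rewrite hg /= e0 (hw i (ltn_ord i)).
by move: h5; rewrite hf /= e4 e1.
Qed.

Lemma prec_rules_sound R Rf Rg k (f : recf k) (g : recf k.+2) :
  means R (reval (RPrec f g)) -> means Rf (reval f) -> means Rg (reval g) ->
  forall r, r \in prec_rules R Rf Rg -> bsat J r.
Proof.
move=> hR hf hg r; rewrite !inE => /orP[] /eqP -> {r};
  apply: (drule_sound hR) => e v r e0 e1 /=.
  rewrite e0 hf e1; case: (e 3) => [i|]; [|tauto].
  case: (e 4) => [|w]; [tauto|].
  case=> [[w' ->]] [[-> _]] [[i' [_ ->]]] [h _].
  by exists (fun=> r).
rewrite e0 hR hg e1.
case: (e 3) => [n'|]; [|tauto].
case: (e 4) => [n|]; [|tauto].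
case: (e 5) => [|w]; [tauto|].
case: (e 6) => [|l]; [tauto|].
  case: (e 7) => [t|]; [|tauto].
case: (e 8) => [|l8]; [tauto|].
case: (e 9) => [|l9]; [tauto|].
case=> [[w' ->]] [->] [[n1 [_ ->]]] [[w2 ->]] [[n2 [_ ->]]] [[T [T0 TS ->]]].
case=> [[w3 ->]] [[n3 [_ ->]]] [[w4 ->]] [[n4 [_ ->]]] [h _].
(* The table up to [n], extended by the new value at [n.+1]. *)
exists (fun i => if i <= n then T i else r); split; rewrite ?ltnn //=.
move=> i; rewrite ltnS => lin; rewrite lin.
by case: ltngtP lin => // [lin|->] _; [exact: TS|].
Qed.

Lemma mu_rules_sound R Rf Rs k (f : recf k.+1) :
  means R (reval (RMu f)) -> means Rf (reval f) ->
  means Rs (fun v r => forall i, i < r -> exists j, reval f (i :: v) j.+1) ->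
  forall r, r \in mu_rules R Rf Rs -> bsat J r.
Proof.
move=> hR hf hs r; rewrite !inE => /or3P[] /eqP -> {r}.
- apply: (drule_sound hs) => e v r e0 e1 /=.
  by rewrite e1 => -[[-> _] _].
- apply: (drule_sound hs) => e v r e0 e1 /=.
  rewrite hs hf e0 e1; case: (e 3) => [r'|]; [|tauto].
  case: (e 4) => [|l]; [tauto|].
  case: (e 5) => [y|]; [|tauto].
  case: (e 6) => [j|]; [|tauto].
  case=> h [->] [[w ->]] [[r2 [_ ->]]] [hf' [ey _]].
  move=> i; rewrite ltnS leq_eqVlt => /orP[/eqP->|/h//].
  by exists j; rewrite -ey.
apply: (drule_sound hR) => e v r e0 e1 /=.
rewrite hs hf e0 e1.
case: (e 3) => [|l]; [tauto|].
  case: (e 4) => [y|]; [|tauto].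
by case=> h [[w ->]] [[r2 [_ ->]]] [h0 [[y0 _] _]]; rewrite y0 in h0; split.
Qed.

(** The hypothesis covers all paths, so prefixing an index specialises it to a subterm. *)
Lemma eval_rules_sound k (f : recf k) N :
  (forall p, means (N p) (sem f p)) ->
  forall r, r \in eval_rules f N -> bsat J r.
Proof.
elim: f N => {k} [k||k i|k m f IHf g IHg|k f IHf g IHg|k f IHf] N h r.
- rewrite inE => /eqP->; apply: (drule_sound (h [::])) => e v x e0 e1 /=.
  by rewrite e1 => -[[]].
- rewrite inE => /eqP->; apply: (drule_sound (h [::])) => e v x e0 e1 /=.
  rewrite e0 e1; case: (e 3) => [y|]; [|tauto].
  by case=> -[w ->] [->].
- by rewrite inE => /eqP->; apply: proj_rule_sound; exact: (h [::]).
- rewrite inE mem_cat => /or3P[/eqP->||].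
  + apply: (comp_rule_sound (h [::])) => [|i x y].
      by rewrite -sem_nil; exact: (h [:: 0]).
    by rewrite (h [:: i.+1]) /= valK sem_nil.
  + by apply: IHf => p x y; exact: (h (0 :: p)).
  case/flatten_mapP=> i _; apply: IHg => p x y.
  by rewrite /= (h (i.+1 :: p)) /= valK.
- rewrite mem_cat mem_cat => /or3P[||].
  + by apply: (prec_rules_sound (h [::])); rewrite -sem_nil;
      [exact: (h [:: 0]) | exact: (h [:: 1])].
  + by apply: IHf => p x y; exact: (h (0 :: p)).
  by apply: IHg => p x y; exact: (h (1 :: p)).
rewrite mem_cat => /orP[|].
  apply: (mu_rules_sound (h [::]) _ (h [:: 1])).
  by rewrite -sem_nil; exact: (h [:: 0]).
by apply: IHf => p x y; exact: (h (0 :: p)).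
Qed.

End Soundness.

Lemma means_rE E a b p : means E a b (rE p) (E p).
Proof. by move=> [?|?] [?|?]; rewrite /std /rE ?pickleK. Qed.

Lemma all_rules_sound (f : recf 2) a b :
  ~ reval f [:: a; b] 1 ->
  forall r, r \in all_rules f -> bsat (std (sem f) a b) r.
Proof.
move=> nf r; rewrite 3!inE => /or4P[/eqP->|/eqP->|/eqP->|].
- move=> e /= [].
  case e0: (e 0) => [i|//]; case e1: (e 1) => [j|//] _ _.
  exists (fun n => if n == 2 then inl j.+1 else e n); rewrite /= e1.
  by split=> // n; rewrite !inE => /orP[] /eqP->.
- move=> e /= [].
  case e0: (e 0) => [i|//]; case e1: (e 1) => [j|//] _ [].
  case e2: (e 2) => [//|v] _ _.
  exists (fun n => if n == 3 then inr (i :: v) else e n); rewrite /= e0 e2.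
  split; last by split=> //; split; [exists v | split=> //; exists i].
  by move=> n; rewrite !inE => /or4P[] /eqP->.
(* As [rGoal] is empty, the body must be refuted: it would make 1 the value of [f] on
   [[:: a; b]]. *)
- apply: (@drule_sound _ _ _ _ (fun _ _ => False)); first by move=> [?|?] [?|?].
  move=> e v r0 e0 e1 [h3 [h4 [h5 [h6 [h7 [h8 [h9 [hE hz]]]]]]]].
  rewrite means_rE in hE; move: h3 h4 h5 h6 h7 h8 h9 hE hz => /=; rewrite e0 e1.
  case: (e 3) => [x|]; [|tauto].
  case: (e 4) => [y|]; [|tauto].
  case: (e 5) => [|l5]; [tauto|].
  case: (e 6) => [|l6]; [tauto|].
  case: (e 7) => [z|]; [|tauto].
  move=> [-> _] [-> _] [-> _] [w ->] [n [_ ->]] [w' ->] [n' [_ ->]] h.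
  by move=> [[z0 _] [er _]]; apply: nf; rewrite er z0 sem_nil in h.
by apply: eval_rules_sound => p; exact: means_rE.
Qed.

(** * Instances with source and target copies *)

(* The base relation [R] has source name [2R], and target copy [2R + 1]. *)
Definition src_atom (a : batom) : atom nat := (a.1.1.*2, [:: a.1.2; a.2]).

Definition tgt_atom (a : batom) : atom nat := (a.1.1.*2.+1, [:: a.1.2; a.2]).

Definition tgd_of (r : brule) : tgd := (map src_atom r.1, map tgt_atom r.2).

(** A strict bound on the names in the rules; the added 9 also covers those of the input fact. *)
Definition rel_bound (f : recf 2) : nat :=
  (\max_(r <- all_rules f) \max_(a <- r.1 ++ r.2) a.1.1).+4.+4.+1.

Definition xy : seq bool := [:: false; true].

Definition copy_form (R : nat) : gform :=
  GAll xy (R.*2.+1, xy) (GAtom (R.*2, xy)).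

(** The syntax wants a formula beside the guard, so the atom is repeated. *)
Definition no_goal_form : gform :=
  GNot (GEx xy (rGoal.*2, xy) (GAtom (rGoal.*2, xy))).

Definition constr_of (K : nat) : gform :=
  foldr (fun R => GAnd (copy_form R)) no_goal_form (iota 0 K).

(* Variable 0 is the empty list, and variable [i.+1] the number [i]. *)
Fixpoint path_fact (n : nat) : seq batom :=
  if n is n'.+1 then (rS, n, n.+1) :: path_fact n'
  else [:: (rNil, 0, 0); (rL, 0, 0); (rZ, 1, 1)].

(** Going one beyond [a + b] provides an [rS] edge even when both inputs are 0, and this starts
    [succ_rule]. *)
Definition input_fact (a b : nat) : seq batom :=
  [:: (rIn1, a.+1, a.+1), (rIn2, b.+1, b.+1) & path_fact (a + b).+1].

(** Only the fact depends on [a] and [b], as the diagonal argument requires. *)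
Definition inst (f : recf 2) (a b : nat) : instance :=
  Instance (nseq (rel_bound f).*2 2) (map src_atom (input_fact a b))
    (map tgd_of (all_rules f)) (constr_of (rel_bound f)).

Lemma rel_bound_lt (f : recf 2) r c :
  r \in all_rules f -> c \in r.1 ++ r.2 -> c.1.1 < rel_bound f.
Proof.
move=> hr hc; rewrite /rel_bound !ltnS; do 8!apply: leqW.
apply: (bigmaxn_sup_seq r) => //.
exact: (leq_bigmax_seq (F := fun c : batom => c.1.1) c).
Qed.

Lemma input_fact_lt a b c : c \in input_fact a b -> c.1.1 < 9.
Proof.
rewrite !inE => /or4P[/eqP->|/eqP->|/eqP->|] //.
elim: (a + b) => [|n IH] /=; last by rewrite inE => /orP[/eqP->|/IH].
by rewrite !inE => /or3P[] /eqP->.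
Qed.

Lemma inst_legal f a b : legal (inst f a b).
Proof.
have src_on c : c.1.1 < rel_bound f ->
    atom_on (nseq (rel_bound f).*2 2) (src_atom c).
  by move=> h; rewrite /atom_on size_nseq nth_nseq /= ltn_double h.
have tgt_on c : c.1.1 < rel_bound f ->
    atom_on (nseq (rel_bound f).*2 2) (tgt_atom c).
  by move=> h; rewrite /atom_on size_nseq nth_nseq /= ltn_Sdouble h.
split.
- by rewrite /= all_nseq orbT.
- apply/allP => _ /mapP[c hc ->]; apply: src_on.
  by apply: leq_trans (input_fact_lt hc) _.
- apply/allP => _ /mapP[r hr ->]; rewrite /tgd_on /conj_on !all_map.
  apply/andP; split; apply/allP => c hc /=; [apply: src_on | apply: tgt_on];
    by apply: rel_bound_lt hr _; rewrite mem_cat hc ?orbT.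
- exists (fun n => ~~ odd n) => _ /mapP[r _ ->].
  by rewrite !all_map; apply/andP; split; apply/allP => c _ /=;
    rewrite ?negbK odd_double.
have atom_ok R : R < (rel_bound f).*2 ->
    atom2_on (nseq (rel_bound f).*2 2) (R, xy).
  by move=> h; rewrite /atom2_on /atom_on size_nseq nth_nseq /= h.
rewrite [sig _]/= [constr _]/= /constr_of.
have : all (ltn^~ (rel_bound f)) (iota 0 (rel_bound f)).
  by apply/allP => R; rewrite mem_iota.
elim: (iota _ _) => [_|R s IH /= /andP[hR /IH[-> ->]]] /=.
  by rewrite !atom_ok.
by rewrite !atom_ok ?ltn_double ?ltn_Sdouble.
Qed.

Lemma no_goal_sat D (I : interp D) e :
  gsat I no_goal_form e <-> forall x y, ~ I rGoal.*2 [:: x; y].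
Proof.
split=> [h x y hI|h [e' [_ [hI _]]]]; last exact: h hI.
by apply: h; exists (fun z => if z then y else x); split; first by case.
Qed.

Lemma copy_sat D (I : interp D) R e :
  gsat I (copy_form R) e <->
  forall x y, I R.*2.+1 [:: x; y] -> I R.*2 [:: x; y].
Proof.
split=> [h x y|h e' _]; last exact: h.
by apply: (h (fun z => if z then y else x)); case.
Qed.

Lemma constr_sat D (I : interp D) K e :
  gsat I (constr_of K) e <->
  (forall R x y, R < K -> I R.*2.+1 [:: x; y] -> I R.*2 [:: x; y])
  /\ (forall x y, ~ I rGoal.*2 [:: x; y]).
Proof.
have H s : gsat I (foldr (fun R => GAnd (copy_form R)) no_goal_form s) e <->
    (forall R, R \in s -> forall x y, I R.*2.+1 [:: x; y] -> I R.*2 [:: x; y])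
    /\ (forall x y, ~ I rGoal.*2 [:: x; y]).
  elim: s => [|R s IH]; first by split=> [/no_goal_sat|[_ /no_goal_sat]].
  split=> [[/copy_sat h /IH[hs hg]]|[h hg]].
    by split=> // R'; rewrite inE => /orP[/eqP->|/hs].
  split; first by apply/copy_sat; apply: h; rewrite inE eqxx.
  by apply/IH; split=> // R' hR'; apply: h; rewrite inE hR' orbT.
split=> [/H[h hg]|[h hg]].
  by split=> // R x y lt; apply: h; rewrite mem_iota.
by apply/H; split=> // R; rewrite mem_iota => lt x y; exact: h.
Qed.

Lemma conj_vars_src b : conj_vars (map src_atom b) = bvars b.
Proof. by rewrite /conj_vars -map_comp. Qed.

Lemma map_bholds D (I : interp D) (J : nat -> D -> D -> Prop) e b
    (F : batom -> atom nat) :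
  (forall c, (F c).2 = [:: c.1.2; c.2]) ->
  (forall c, c \in b -> forall x y, J c.1.1 x y -> I (F c).1 [:: x; y]) ->
  bholds J e b -> holds_conj I e (map F b).
Proof.
move=> hF hI /bholds_in h _ /mapP[c hc ->].
by rewrite /holds hF; apply: hI => //; exact: h.
Qed.

Lemma bholds_map D (I : interp D) (J : nat -> D -> D -> Prop) e b
    (F : batom -> atom nat) :
  (forall c, (F c).2 = [:: c.1.2; c.2]) ->
  (forall c, c \in b -> forall x y, I (F c).1 [:: x; y] -> J c.1.1 x y) ->
  holds_conj I e (map F b) -> bholds J e b.
Proof.
move=> hF hI h; apply/bholds_in => c hc; apply: hI => //.
by have := h _ (map_f F hc); rewrite /holds hF.
Qed.

Lemma not_reval_satisfiable (f : recf 2) a b :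
  ~ reval f [:: a; b] 1 -> satisfiable (inst f a b).
Proof.
move=> nf; pose J := std (sem f) a b.
(* Halving a name gives a relation and its target copy the same interpretation. *)
exists (nat + seq nat)%type,
  (fun R s => if s is [:: x; y] then J R./2 x y else False).
split=> [|_ /mapP[r hr ->]|e].
- exists (fun i => if i is j.+1 then inl j else inr [::]).
  apply: (@map_bholds _ _ J) => // [c _ x y|]; first by rewrite /= doubleK.
  by do 2!split=> //; elim: (a + b).+1 => [//|n IH]; split.
- move=> e he.
  have [|e' [ee' h']] := all_rules_sound nf hr (e := e).
    by apply: bholds_map he => // c _ x y; rewrite /= doubleK.
  exists e'; rewrite conj_vars_src; split=> //.
  by apply: map_bholds h' => // c _ x y /=; rewrite uphalf_double.
apply/constr_sat; split=> [R x y _|x y]; last by rewrite doubleK; case: x y => [?|?] [?|?].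
by rewrite /= uphalf_double doubleK.
Qed.

(** In any model [succ_rule] and [cons_rule] supply numbers and lists; completeness then derives the
    value 1, and [goal_rule] violates the constraint. *)
Lemma satisfiable_not_reval (f : recf 2) a b :
  satisfiable (inst f a b) -> ~ reval f [:: a; b] 1.
Proof.
case=> D [I [[e0 hfact] hrules hconstr]] hf.
have /constr_sat[hcopy hgoal] := hconstr (fun=> e0 0).
pose J R x y := I R.*2 [:: x; y].
have {}hfact : bholds J e0 (input_fact a b) by apply: bholds_map hfact.
have hJ r : r \in all_rules f -> bsat J r.
  move=> hr e he; have [|e' [ee' h']] := hrules _ (map_f tgd_of hr) e.
    by apply: map_bholds he.
  exists e'; rewrite -conj_vars_src; split=> //.
  apply: bholds_map h' => // c hc x y; apply: hcopy.
  by apply: rel_bound_lt hr _; rewrite mem_cat hc orbT.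
have hpath n : bholds J e0 (path_fact n) -> forall i, i < n ->
    J rS (e0 i.+1) (e0 i.+2).
  elim: n => // n IH [hn /IH h] i; rewrite ltnS leq_eqVlt.
  by case/orP=> [/eqP->|/h].
have hbase n : bholds J e0 (path_fact n) ->
    [/\ J rNil (e0 0) (e0 0), J rL (e0 0) (e0 0) & J rZ (e0 1) (e0 1)].
  by elim: n => [[h1 [h2 [h3 _]]]|n IH []].
case: hfact => [hin1 [hin2 hfact]].
have [hnil hL hZ] := hbase (a + b).+1 hfact.
have {hbase hpath}hS := hpath (a + b).+1 hfact.
pose next d := epsilon (inhabits d) (fun d' => J rS d d').
have nextP d d' : J rS d' d -> J rS d (next d).
  move=> h; apply: epsilon_spec.
  have [|e' [ee' [/= hd _]]] := hJ _ (mem_head _ _) (nth d [:: d'; d]).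
    by split.
  by rewrite (ee' 1) // in hd; exists (e' 2).
(* Up to [n] these are the elements of the fact, so [num a] and [num b] carry the marks [rIn1] and
   [rIn2]; beyond [n], successors are chosen. *)
pose n := (a + b).+1; pose num i := iter (i - n) next (e0 (minn i n).+1).
have num_e0 i : i <= n -> num i = e0 i.+1.
  by move=> le; rewrite /num (minn_idPl le) (eqP le).
have numS i : J rS (num i) (num i.+1).
  elim: i => [|i IH]; first by rewrite !num_e0 //; exact: hS.
  case: (ltnP i.+1 n) => [lt|le].
    by rewrite !num_e0 ?(ltnW lt) //; exact: hS.
  have -> : num i.+2 = next (num i.+1).
    by rewrite /num subSn // (minn_idPr le) (minn_idPr (leqW le)).
  exact: nextP IH.
have numZ : J rZ (num 0) (num 0) by rewrite num_e0.
pose is_cons x d c := [/\ J rL c c, J rHd c x & J rTl c d].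
pose lst v := foldr (fun i d => epsilon (inhabits d) (is_cons (num i) d)) (e0 0) v.
(* The chosen cell is correct once the tail is known to be a list, which [lstL] then proves by
   induction. *)
have consP i v : J rL (lst v) (lst v) ->
    is_cons (num i) (lst v) (lst (i :: v)).
  move=> hv; apply: epsilon_spec.
  have [||e' [ee' [/= h1 [h2 [h3 _]]]]] := hJ cons_rule _
    (nth (e0 0) [:: num i; num i.+1; lst v]).
  - by rewrite !inE eqxx orbT.
  - by split; [exact: numS | split].
  by rewrite (ee' 0) // (ee' 2) // in h2 h3; exists (e' 3); split.
have lstL v : J rL (lst v) (lst v) by elim: v => [//|i v /(consP i)[]].
have lstP i v := consP i v (lstL v).
have lst_hd i v : J rHd (lst (i :: v)) (num i) by case: (lstP i v).
have lst_tl i v : J rTl (lst (i :: v)) (lst v) by case: (lstP i v).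
have hE : J (rE [::]) (lst [:: a; b]) (num 1).
  apply: (eval_rules_complete numZ numS lstL hnil lst_hd lst_tl (f := f)) => //.
  by move=> r hr; apply: hJ; rewrite !inE hr !orbT.
apply: (hgoal (lst [:: a; b]) (num 1)).
have hg : bsat J goal_rule by apply: hJ; rewrite !inE eqxx !orbT.
apply: (drule_derive numS lstL hg (e := nth (num 0) [:: lst [:: a; b]; num 1;
  num 2; num a; num b; lst [::]; lst [:: b]; num 0])) => //.
have ha : J rIn1 (num a) (num a) by rewrite num_e0 // leqW ?leq_addr.
have hb : J rIn2 (num b) (num b) by rewrite num_e0 // leqW ?leq_addl.
by do 11?split=> //; by [exact: lst_hd | exact: lst_tl | exact: numS].
Qed.

(** * Computability of the code of the input fact *)

Definition computable k (F : seq nat -> nat) :=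
  exists f : recf k, forall v, size v = k -> reval f v (F v).

Lemma computable_nth k i : i < k -> computable k (nth 0 ^~ i).
Proof. by move=> lik; exists (RProj (Ordinal lik)). Qed.

Lemma computable_comp1 k (F : nat -> nat) G :
  computable 1 (fun v => F (nth 0 v 0)) -> computable k G ->
  computable k (fun v => F (G v)).
Proof.
move=> [f hf] [g hg]; exists (RComp f (fun=> g)) => v sz /=.
by exists [:: G v]; split=> [//|[[|//] ?]|]; [exact: hg | exact: hf].
Qed.

Lemma computable_comp2 k (F : nat -> nat -> nat) G H :
  computable 2 (fun v => F (nth 0 v 0) (nth 0 v 1)) ->
  computable k G -> computable k H -> computable k (fun v => F (G v) (H v)).
Proof.
move=> [f hf] [g hg] [h hh].
exists (RComp f (fun i : 'I_2 => if val i == 0 then g else h)) => v sz /=.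
exists [:: G v; H v]; split=> [//|[[|[|//]] ?]|]; last exact: hf.
  exact: hg.
exact: hh.
Qed.

(** The table required by [reval] is [T^~ w]. *)
Lemma computable_prec k (F0 G : seq nat -> nat) (T : nat -> seq nat -> nat) :
  computable k F0 -> computable k.+2 G ->
  (forall w, T 0 w = F0 w) -> (forall n w, T n.+1 w = G [:: n, T n w & w]) ->
  computable k.+1 (fun v => T (head 0 v) (behead v)).
Proof.
move=> [f hf] [g hg] T0 TS; exists (RPrec f g) => -[//|n w] [sz] /=.
exists (T^~ w); split=> [|i _|//]; first by rewrite T0; exact: hf.
by rewrite TS; apply: hg; rewrite /= sz.
Qed.

Lemma computable_succ k G : computable k G -> computable k (fun v => (G v).+1).
Proof. by apply: (@computable_comp1 _ succn); exists RSucc. Qed.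

Lemma computable_const k c : computable k (fun=> c).
Proof.
elim: c => [|c IH]; first by exists (RZero k).
exact: (computable_succ IH).
Qed.

Lemma computable_add k G H :
  computable k G -> computable k H -> computable k (fun v => G v + H v).
Proof.
apply: (@computable_comp2 _ addn).
have [] := @computable_prec 1 (nth 0 ^~ 0) (fun v => (nth 0 v 1).+1)
  (fun n w => n + nth 0 w 0) _ _ _ _ => //.
- exact: computable_nth.
- exact/computable_succ/computable_nth.
(* Once [v] is a cons, [head] and [behead] convert to the wanted entries. *)
by move=> f hf; exists f => v sz; case: v sz (hf v sz).
Qed.

(** Pascal's rule makes the triangular numbers a recursive sum. *)
Lemma computable_tri : computable 1 (fun v => 'C((nth 0 v 0).+1, 2)).
Proof.
have [] := @computable_prec 0 (fun=> 0) (fun v => nth 0 v 1 + (nth 0 v 0).+1)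
  (fun n _ => 'C(n.+1, 2)) _ _ _ _ => //.
- exact: computable_const.
- apply: computable_add; first exact: computable_nth.
  exact/computable_succ/computable_nth.
- by move=> n w; rewrite /= binS bin1.
by move=> f hf; exists f => v sz; case: v sz (hf v sz).
Qed.

Lemma computable_cpair k G H :
  computable k G -> computable k H -> computable k (fun v => cpair (G v) (H v)).
Proof.
move=> hG hH; apply: computable_add => //.
apply: (@computable_comp1 _ (fun n => 'C(n.+1, 2))) computable_tri _.
exact: computable_add.
Qed.

Lemma computable_atom k R G H :
  computable k G -> computable k H ->
  computable k (fun v => code_atom id (src_atom (R, G v, H v))).
Proof.
move=> hG hH; apply: computable_cpair; first exact: computable_const.
apply/computable_succ/computable_cpair => //.
by apply/computable_succ/computable_cpair => //; exact: computable_const.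
Qed.

Lemma computable_path_fact k G :
  computable k G ->
  computable k (fun v => code_conj (map src_atom (path_fact (G v)))).
Proof.
apply: (@computable_comp1 _ (fun n => code_conj (map src_atom (path_fact n)))).
have [] := @computable_prec 0 (fun=> code_conj (map src_atom (path_fact 0)))
  (fun v => (cpair (code_atom id
     (src_atom (rS, (nth 0 v 0).+1, (nth 0 v 0).+2))) (nth 0 v 1)).+1)
  (fun n _ => code_conj (map src_atom (path_fact n))) _ _ _ _ => //.
- exact: computable_const.
- apply/computable_succ/computable_cpair; last exact: computable_nth.
  by apply: computable_atom; do !apply: computable_succ; exact: computable_nth.
by move=> f hf; exists f => v sz; case: v sz (hf v sz).
Qed.

Lemma computable_input_fact k G H :
  computable k G -> computable k H ->
  computable k (fun v => code_conj (map src_atom (input_fact (G v) (H v)))).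
Proof.
move=> hG hH; apply/computable_succ/computable_cpair.
  by apply: computable_atom; exact: computable_succ.
apply/computable_succ/computable_cpair.
  by apply: computable_atom; exact: computable_succ.
exact: (computable_path_fact (computable_succ (computable_add hG hH))).
Qed.

(** * Diagonalisation *)

Definition rest_code (f : recf 2) : nat :=
  cpair (code_seq code_tgd (map tgd_of (all_rules f)))
        (code_gform (constr_of (rel_bound f))).

Lemma code_inst f a b :
  code_instance (inst f a b) =
  cpair (code_seq id (nseq (rel_bound f).*2 2))
    (cpair (code_conj (map src_atom (input_fact a b))) (rest_code f)).
Proof.
(* Left to conversion, this would unfold [cpair] into binomials. *)
rewrite /code_instance /rest_code /inst.
by cbv beta iota delta [sig fact rules constr].
Qed.

(** By [code_inst], this value is the code of an instance when [a] codes its signature and [b] its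
    rules and constraint; its fact then encodes these very codes. *)
Lemma computable_code : exists s : recf 2, forall a b,
  reval s [:: a; b]
    (cpair a (cpair (code_conj (map src_atom (input_fact a b))) b)).
Proof.
have h0 : computable 2 (nth 0 ^~ 0) by exact: computable_nth.
have h1 : computable 2 (nth 0 ^~ 1) by exact: computable_nth.
have [s hs] := computable_cpair h0
  (computable_cpair (computable_input_fact h0 h1) h1).
by exists s => a b; exact: (hs [:: a; b]).
Qed.

Theorem theorem3p1 : undecidable_on code_instance legal satisfiable.
Proof.
case=> f hf; have [s hs] := computable_code.
pose d := RComp f (fun=> s).
(* With [rest_code d] as second input, [s] returns the code of the instance built from [d] and these
   two inputs. *)
set a := code_seq id (nseq (rel_bound d).*2 2).
have hc := hs a (rest_code d); rewrite -code_inst in hc.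
(* Abstracting the codes prevents their evaluation. *)
move: a (rest_code d) hc => a b hc; have [h1 h0] := hf _ (inst_legal d a b).
move: (code_instance _) hc h1 h0 => c hc h1 h0.
have hd : reval f [:: c] 1 <-> reval d [:: a; b] 1.
  split=> [h|[ws [sz /(_ ord0) hw h]]].
    by exists [:: c]; split=> // i; rewrite ord1.
  case: ws sz hw h => [|c' [|]] // _ hw.
  by have /= -> := reval_fun hc hw.
(* A satisfiable instance would make [f], hence [d], return 1, which satisfiability excludes. So [f]
   returns 0, [d] does not return 1, and the instance is satisfiable after all. *)
have nsat : ~ satisfiable (inst d a b).
  by move=> sat; apply: (satisfiable_not_reval sat); apply/hd; exact: h1.
apply: (nsat); apply: not_reval_satisfiable => /hd hr.
by have := reval_fun hr (h0 nsat).
Qed.
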